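(* For all $\lambda,\nu\in\mathcal S_n$, $$\sum_{\mu\subseteq\nu}\chi^\lambda_\mu\,\frac{(-1)^{|\nu-\mu|}}{q^{\mathrm{nst}^\nu_{\nu-\mu}}} =\frac{(-1)^{|\nu|}\,q^{\dim(\lambda)}\,(q-1)^{|\lambda-\nu|}}{q^{|\lambda|+\mathrm{snst}^\lambda_\nu+\mathrm{nst}^\nu_\nu}} \prod_{i\frown j\in\nu\cap\lambda}\Bigl((q-1)q^{\mathrm{nst}^\lambda_{i\frown j}}+q^{\mathrm{nst}^\nu_{i\frown j}}\Bigr) \prod_{\substack{i\frown j\in\nu-\lambda\\ i\frown j\notin\mathrm{cflt}(\lambda)}}\Bigl(q^{\mathrm{nst}^\lambda_{i\frown j}}-q^{\mathrm{nst}^\nu_{i\frown j}}\Bigr),$$ where the sum on the left is over all $\mu\in\mathcal S_n$ with $\mu\subseteq\nu$ (as sets of arcs).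
   Context: For $n\ge 0$, $\mathcal S_n$ denotes the set of set partitions of $\{1,\dots,n\}$, encoded as sets of arcs: a set partition is a subset $\lambda\subseteq\{i\frown j\mid 1\le i<j\le n\}$ (arcs are just pairs $(i,j)$ with $i<j$) such that for all $i<j<k$, $i\frown k\in\lambda$ implies $i\frown j\notin\lambda$ and $j\frown k\notin\lambda$. $|\lambda|$ is the number of arcs, and $\nu-\mu$ is set difference. For sets of arcs $\lambda,\mu$ put $\dim(\lambda)=\sum_{i\frown j\in\lambda}(j-i)$; $\mathrm{nst}^\lambda_\mu=\#\{i<j<k<l\mid i\frown l\in\lambda,\ j\frown k\in\mu\}$, and $\mathrm{nst}^\lambda_{i\frown j}=\mathrm{nst}^\lambda_{\{i\frown j\}}$; $\mathrm{cflt}(\lambda)=\{j\frown k\mid \text{there exists } i\frown l\in\lambda \text{ with } i=j<k<l \text{ or } i<j<k=l\}$; $\mathrm{snst}^\lambda_\mu=\#\{i<j<k<l\mid i\frown l\in\lambda,\ j\frown k\in\mu-\mathrm{cflt}(\lambda)\}$. $\chi^\lambda_\mu$ is the value of the supercharacter $\chi^\lambda$ of the group $\mathrm{UT}_n(q)$ of $n\times n$ unipotent upper triangular matrices over $\mathbb F_q$ on the superclass indexed by $\mu$; it is given by $$\chi^\lambda_\mu=\frac{(q-1)^{|\lambda|-|\lambda\cap\mu|}\,q^{\dim(\lambda)-|\lambda|}\,(-1)^{|\lambda\cap\mu|}}{q^{\mathrm{nst}^\lambda_\mu}}$$ if for all $i<j<k$ with $i\frown k\in\lambda$ one has $i\frown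 j\notin\mu$ and $j\frown k\notin\mu$; and $\chi^\lambda_\mu=0$ otherwise. *)

(* Defs.v *)
From mathcomp Require Import all_boot all_order all_algebra all_field.

Set Implicit Arguments.
Unset Strict Implicit.
Unset Printing Implicit Defensive.

Import GRing.Theory Num.Theory.

(* The vertices 1, ..., n are represented by 0, ..., n - 1 (the type 'I_n).   *)
(* The pair (i, j) stands for the arc from i to j; a set of pairs is a set of *)
(* arcs when all its elements satisfy i < j.                                  *)
Definition arcset (n : nat) : finType := {set 'I_n * 'I_n}.

Definition set_partitions (n : nat) : {set arcset n} :=
  [set lam : arcset n |
     [forall a in lam, a.1 < a.2] &&
     [forall i : 'I_n, forall j : 'I_n, forall k : 'I_n,
        [&& i < j, j < k & (i, k) \in lam] ==>
        ((i, j) \notin lam) && ((j, k) \notin lam)]].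

Definition arc_dim (n : nat) (lam : arcset n) : nat :=
  \sum_(a in lam) (a.2 - a.1).

Definition nst (n : nat) (lam mu : arcset n) : nat :=
  #|[set x : 'I_n * 'I_n * 'I_n * 'I_n |
       let: (i, j, k, l) := x in
       [&& i < j, j < k, k < l, (i, l) \in lam & (j, k) \in mu]]|.

Definition cflt (n : nat) (lam : arcset n) : arcset n :=
  [set a : 'I_n * 'I_n | let: (j, k) := a in
     [exists i : 'I_n, exists l : 'I_n, ((i, l) \in lam) &&
        ([&& i == j, j < k & k < l] || [&& i < j, j < k & k == l])]].

Definition snst (n : nat) (lam mu : arcset n) : nat :=
  nst lam (mu :\: cflt lam).

(* The value of the supercharacter of UT_n(q) indexed by lam on the           *)
(* superclass indexed by mu, given by its explicit formula. For set           *)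
(* partitions lam both truncated subtractions are exact, every arc having     *)
(* length at least 1.                                                         *)
Definition schar (n : nat) (q : algC) (lam mu : arcset n) : algC :=
  if [forall i : 'I_n, forall j : 'I_n, forall k : 'I_n,
        [&& i < j, j < k & (i, k) \in lam] ==>
        ((i, j) \notin mu) && ((j, k) \notin mu)]
  then ((q - 1) ^+ (#|lam| - #|lam :&: mu|) * q ^+ (arc_dim lam - #|lam|)
          * (-1) ^+ #|lam :&: mu| / q ^+ nst lam mu)%R
  else 0%R.

(* Main.v *)
(* The nesting numbers are additive in their second argument and the value    *)
(* chi^lam_mu vanishes unless mu avoids cflt(lam), so every summand is a      *)
(* constant times a product of one factor per arc of nu, the factor depending *)
(* only on whether the arc lies in mu. The sum over all subsets mu of nu is   *)
(* therefore the expansion of a product of binomials over the arcs of nu.     *)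

Require Import Defs.
From mathcomp Require Import all_boot all_order all_algebra all_field.
From mathcomp Require Import ring.

Import GRing.Theory Num.Theory.
Local Open Scope ring_scope.

(** For fixed [lam], both factors of a summand are multiplicative over arcs: [schar_prod] does this
    for the character, [expr_nst] for the powers of q. By [prodrD_subsets] the sum is a constant
    times a product over [a] in [nu] of binomials w - 1/y. Put x = q^nst(lam,a) and y = q^nst(nu,a).
    The binomial is -((q-1)x + y)/((q-1)xy) for an arc of [lam], -1/y for an arc in conflict with
    [lam], and -(x - y)/(xy) otherwise. Collecting numerators and denominators gives the right-hand
    side. *)

Lemma prodrD_subsets (R : comNzRingType) (I : finType) (A : {set I}) (F G : I -> R) :
  \prod_(i in A) (F i + G i) =
  \sum_(B : {set I} | B \subset A) \prod_(i in B) F i * \prod_(i in A :\: B) G i.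
Proof.
(* Extending by 0 and 1 outside [A] allows distributing over the whole type: sets not inside [A]
   then contribute 0. *)
pose F' i := if i \in A then F i else 0; pose G' i := if i \in A then G i else 1.
rewrite big_mkcond /=.
rewrite (eq_bigr (fun i => F' i + G' i)); last first.
  by move=> i _; rewrite /F' /G'; case: ifP => _; rewrite ?add0r.
rewrite bigA_distr [RHS]big_mkcond /=; apply: eq_bigr => B _.
case: ifPn => [sBA | /subsetPn[x xB xNA]]; last first.
  by rewrite (bigD1 x) //= xB /F' (negPf xNA) mul0r.
rewrite [X in _ = X * _]big_mkcond [X in _ = _ * X]big_mkcond -big_split /=.
apply: eq_bigr => i _; rewrite in_setD /F' /G'.
by case: (boolP (i \in B)) => [/(subsetP sBA)-> | _] /=; rewrite ?mulr1 ?mul1r.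
Qed.

Lemma nst_sum (n : nat) (lam mu : arcset n) :
  nst lam mu = (\sum_(a in mu) nst lam [set a])%N.
Proof.
rewrite /nst -sum1_card.
(* Nestings are sorted by their inner arc. *)
pose inner (x : 'I_n * 'I_n * 'I_n * 'I_n) := let: (i, j, k, l) := x in (j, k).
rewrite (partition_big inner [in mu]) /=; last first.
  by move=> [[[i j] k] l]; rewrite inE => /and5P[].
apply: eq_bigr => a amu; rewrite -sum1_card; apply: eq_bigl => -[[[i j] k] l].
rewrite !inE /=; case: eqP => [-> | _]; last by rewrite !andbF.
by rewrite amu !andbT.
Qed.

Lemma expr_nst (R : comNzRingType) (q : R) (n : nat) (lam mu : arcset n) :
  q ^+ nst lam mu = \prod_(a in mu) q ^+ nst lam [set a].
Proof. by rewrite nst_sum prodrXr. Qed.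

(** The axioms only forbid arcs, so they pass to subsets; hence the sum runs over all subsets of
    [nu]. *)
Lemma set_partitionsS (n : nat) (mu nu : arcset n) :
  nu \in set_partitions n -> mu \subset nu -> mu \in set_partitions n.
Proof.
rewrite !inE => /andP[/forall_inP lt_nu /forallP sp_nu] /subsetP s_mu.
apply/andP; split; first by apply/forall_inP => a /s_mu/lt_nu.
apply/forallP=> i; apply/forallP=> j; apply/forallP=> k; apply/implyP=> /and3P[ij jk].
move=> /s_mu ik; have /forallP/(_ j)/forallP/(_ k) := sp_nu i.
by rewrite ij jk ik /= => /andP[]; do 2![move/(contra (s_mu _)) => ->].
Qed.

Lemma schar_supportE (n : nat) (lam mu : arcset n) :
  [forall i : 'I_n, forall j : 'I_n, forall k : 'I_n,
     [&& (i < j)%N, (j < k)%N & (i, k) \in lam] ==>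
     ((i, j) \notin mu) && ((j, k) \notin mu)] = [disjoint mu & cflt lam].
Proof.
apply/forallP/pred0P => [no_cflt [j k] | no_cflt i].
  apply/negP; rewrite /= inE => /andP[jk_mu /existsP[i /existsP[l /andP[il_lam]]]].
  case/orP=> /and3P[].
    move=> /eqP eij jk kl; subst j.
    have /forallP/(_ k)/forallP/(_ l) := no_cflt i.
    by rewrite jk kl il_lam jk_mu.
  move=> ij jk /eqP ekl; subst l.
  have /forallP/(_ j)/forallP/(_ k) := no_cflt i.
  by rewrite jk ij il_lam jk_mu andbF.
apply/forallP=> j; apply/forallP=> k; apply/implyP=> /and3P[ij jk ik].
apply/andP; split; apply/negP => in_mu.
  move: (no_cflt (i, j)); rewrite /= in_mu inE /= => /existsP[]; exists i.
  by apply/existsP; exists k; rewrite ik eqxx ij jk.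
move: (no_cflt (j, k)); rewrite /= in_mu inE /= => /existsP[]; exists i.
by apply/existsP; exists k; rewrite ik eqxx ij jk orbT.
Qed.

(** Makes the cases of [schar_weight] exclusive: a set partition avoids its own conflicts, by
    [schar_supportE] with [mu] equal to [lam]. *)
Lemma set_partition_cfltF (n : nat) (lam : arcset n) (a : 'I_n * 'I_n) :
  lam \in set_partitions n -> a \in lam -> a \notin cflt lam.
Proof.
by rewrite inE schar_supportE => /andP[_ dis] a_lam; rewrite (disjointFr dis).
Qed.

Lemma card_le_arc_dim (n : nat) (lam : arcset n) :
  lam \in set_partitions n -> (#|lam| <= arc_dim lam)%N.
Proof.
rewrite inE => /andP[/forall_inP lt_lam _]; rewrite -sum1_card.
by apply: leq_sum => a /lt_lam; rewrite subn_gt0.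
Qed.

(** A conflicting arc kills the character; an arc shared with [lam] trades a factor q - 1 for -1,
    hence the quotient -1/(q - 1). *)
Definition schar_weight {n : nat} (q : algC) (lam : arcset n) (a : 'I_n * 'I_n) :=
  if a \in cflt lam then 0
  else (if a \in lam then - (q - 1)^-1 else 1) / q ^+ nst lam [set a].

Lemma schar_prod (n : nat) (q : algC) (lam mu : arcset n) :
    q != 0 -> q - 1 != 0 -> lam \in set_partitions n ->
  schar q lam mu = (q - 1) ^+ #|lam| * (q ^+ arc_dim lam / q ^+ #|lam|)
                   * \prod_(a in mu) schar_weight q lam a.
Proof.
move=> q0 q1 lamP; rewrite /schar schar_supportE.
case: ifPn => [dis | /pred0Pn[a /= /andP[a_mu a_cflt]]]; last first.
  by rewrite (bigD1 a) //= /schar_weight a_cflt mul0r mulr0.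
have -> : \prod_(a in mu) schar_weight q lam a =
          (- (q - 1)^-1) ^+ #|lam :&: mu| / q ^+ nst lam mu.
  rewrite expr_nst (eq_bigr (fun a => (if a \in lam then - (q - 1)^-1 else 1)
                                 * (q ^+ nst lam [set a])^-1)); last first.
    by move=> a a_mu; rewrite /schar_weight (disjointFr dis).
  rewrite big_split /= prodfV -big_mkcondr /= -prodr_const.
  by congr (_ / _); apply: eq_bigl => a; rewrite inE andbC.
have le_lam : (#|lam :&: mu| <= #|lam|)%N by rewrite subset_leq_card ?subsetIl.
(* The truncated subtractions in the exponents are exact, so they become quotients. *)
rewrite !expfB_cond ?(negPf q0) ?(negPf q1) ?add0n ?card_le_arc_dim //.
by rewrite [(- _^-1) ^+ _]exprNn exprVn; ring.
Qed.

Lemma finField_card_neq0_neq1 (F : finFieldType) :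
  let q : algC := #|F|%:R in q != 0 /\ q - 1 != 0.
Proof.
have F_gt1 : (1 < #|F|)%N.
  by rewrite (cardD1 0) (cardD1 (1 : F)) !inE oner_eq0.
split; first by rewrite pnatr_eq0 -lt0n ltnW.
by rewrite subr_eq0 pnatr_eq1 gtn_eqF.
Qed.

Theorem theorem3p2 (F : finFieldType) (n : nat) (lam nu : arcset n)
    (hlam : lam \in set_partitions n) (hnu : nu \in set_partitions n) :
  let q : algC := #|F|%:R in
  \sum_(mu in set_partitions n | mu \subset nu)
     schar q lam mu * ((-1) ^+ #|nu :\: mu| / q ^+ nst nu (nu :\: mu))
  = (-1) ^+ #|nu| * q ^+ arc_dim lam * (q - 1) ^+ #|lam :\: nu|
      / q ^+ (#|lam| + snst lam nu + nst nu nu)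
    * (\prod_(a in nu :&: lam)
         ((q - 1) * q ^+ nst lam [set a] + q ^+ nst nu [set a]))
    * (\prod_(a in nu :\: lam | a \notin cflt lam)
         (q ^+ nst lam [set a] - q ^+ nst nu [set a])).
Proof.
move=> q; have [q0 q1] : q != 0 /\ q - 1 != 0 by apply: finField_card_neq0_neq1.
clearbody q.
have Xq0 k : q ^+ k != 0 by rewrite expf_neq0.
set K := (q - 1) ^+ #|lam| * (q ^+ arc_dim lam / q ^+ #|lam|).
pose G a : algC := - (q ^+ nst nu [set a])^-1.
pose num a : algC := (q - 1) * q ^+ nst lam [set a] + q ^+ nst nu [set a].
pose dif a : algC := q ^+ nst lam [set a] - q ^+ nst nu [set a].
transitivity (K * \prod_(a in nu) (schar_weight q lam a + G a)).
  rewrite prodrD_subsets big_distrr /=; apply: eq_big => mu.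
    by rewrite andb_idl //; apply: set_partitionsS.
  move=> _; rewrite schar_prod // -/K -mulrA; congr (_ * (_ * _)).
  rewrite expr_nst -prodfV -[(-1) ^+ _]prodr_const -big_split.
  by apply: eq_bigr => a _; rewrite /= mulN1r.
(* The three cases in one shape: -1/y always, 1/x off the conflicts, then a numerator. *)
have factor a : a \in nu -> schar_weight q lam a + G a =
    -1 / q ^+ nst nu [set a] / (if a \notin cflt lam then q ^+ nst lam [set a] else 1)
    * (if a \in lam then (q - 1)^-1 * num a
       else if a \notin cflt lam then dif a else 1).
  move=> _; rewrite /schar_weight /G /num /dif.
  case: (boolP (a \in lam)) => [a_lam | _].
    rewrite (negPf (set_partition_cfltF _ _ _ hlam a_lam)) /=.
    move: (Xq0 (nst lam [set a])) (Xq0 (nst nu [set a])) q1.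
    move: (_ ^+ _) (_ ^+ _) (_ - _) => x y d x0 y0 d0.
    by field; rewrite x0 y0 d0.
  case: (boolP (a \in cflt lam)) => _ /=; first by rewrite add0r divr1 mulr1 mulN1r.
  move: (Xq0 (nst lam [set a])) (Xq0 (nst nu [set a])).
  move: (_ ^+ _) (_ ^+ _) => x y x0 y0.
  by field; rewrite x0 y0.
rewrite (eq_bigr _ factor) !big_split /= prodr_const !prodfV -expr_nst -big_mkcondr /=.
have -> : \prod_(a in nu | a \notin cflt lam) q ^+ nst lam [set a] = q ^+ snst lam nu.
  by rewrite [RHS]expr_nst; apply: eq_bigl => a; rewrite in_setD andbC.
rewrite (big_setID lam) /=.
rewrite (eq_bigr (fun a => (q - 1)^-1 * num a)); last by move=> a /setIP[_ ->].
rewrite big_split /= prodr_const.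
rewrite (eq_bigr (P := [in nu :\: lam])
           (fun a => if a \notin cflt lam then dif a else 1));
  last by move=> a /setDP[_ /negPf->].
rewrite -big_mkcondr /= {}/K.
(* The factors 1/(q - 1) from arcs of both [nu] and [lam] cancel the first power, leaving the
   exponent of [lam :\: nu]. *)
have -> : (q - 1) ^+ #|lam| = (q - 1) ^+ #|nu :&: lam| * (q - 1) ^+ #|lam :\: nu|.
  by rewrite -exprD setIC cardsID.
rewrite !exprD exprVn.
move: (expf_neq0 #|nu :&: lam| q1) (Xq0 #|lam|) (Xq0 (snst lam nu)) (Xq0 (nst nu nu)).
move: (_ ^+ #|nu :&: lam|) (_ ^+ #|lam|) (_ ^+ snst _ _) (_ ^+ nst _ _) => d l s t d0 l0 s0 t0.
by field; rewrite d0 l0 s0 t0.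
Qed.
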